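(* Let $A,B\in\mathbb{C}^{n\times n}$. Then: (a) $R(A^{(B)})=R(BB^\dagger A^* )$ and $N(A^{(B)})=N((AB)^* )$; (b) $A^{(B)}\in A\{2\}$; (c) $A^{(B)}\in A\{1\}$ if and only if $\mathrm{rk}(AB)=\mathrm{rk}(A)$.
   Context: $R(M)$, $N(M)$, $M^*$, $\mathrm{rk}(M)$, $M^\dagger$ denote the range, null space, conjugate transpose, rank and Moore-Penrose inverse of a complex matrix $M$. $A\{1\}$ is the set of matrices $X$ with $AXA=A$, and $A\{2\}$ is the set of matrices $X$ with $XAX=X$. For $A,B\in\mathbb{C}^{n\times n}$, the generalized inverse of $A$ with respect to $B$ is $A^{(B)}:=(ABB^\dagger)^\dagger$. *)

(* Defs.v *)
From mathcomp Require Import all_boot all_order all_algebra.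
From mathcomp Require Import complex.
From mathcomp Require Import boolp classical_sets reals.
Set Implicit Arguments.
Unset Strict Implicit.
Unset Printing Implicit Defensive.
Import Order.TTheory GRing.Theory Num.Theory.

Local Open Scope ring_scope.
Local Open Scope sesquilinear_scope.
Local Open Scope classical_set_scope.

(* Range and null space refer to the action x |-> M *m x on column vectors;
   the row spaces of mxalgebra (A <= B)%MS use the transposed convention. *)
Definition mxrange (C : numClosedFieldType) m n (M : 'M[C]_(m, n)) : set 'cV[C]_m :=
  range (fun x : 'cV[C]_n => M *m x).

Definition mxnull (C : numClosedFieldType) m n (M : 'M[C]_(m, n)) : set 'cV[C]_n :=
  [set x | M *m x = 0].

Definition one_inverses (C : numClosedFieldType) m n (A : 'M[C]_(m, n)) :
  set 'M[C]_(n, m) := [set X | A *m X *m A = A].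

Definition two_inverses (C : numClosedFieldType) m n (A : 'M[C]_(m, n)) :
  set 'M[C]_(n, m) := [set X | X *m A *m X = X].

Section MoorePenrose.
Context {C : numClosedFieldType}.

Definition penrose m n (A : 'M[C]_(m, n)) (X : 'M[C]_(n, m)) : bool :=
  [&& A *m X *m A == A, X *m A *m X == X,
      (A *m X)^t* == A *m X & (X *m A)^t* == X *m A].

Lemma ctmxM m n p (A : 'M[C]_(m, n)) (B : 'M[C]_(n, p)) :
  (A *m B)^t* = B^t* *m A^t*.
Proof. by rewrite trmx_mul map_mxM. Qed.

Lemma mulmx_ct_eq0 m n (A : 'M[C]_(m, n)) : A *m A^t* = 0 -> A = 0.
Proof.
move=> A0; apply/matrixP => i j; rewrite mxE; apply/eqP.
rewrite -normr_eq0 -sqrf_eq0; move/matrixP/(_ i i)/eqP: A0; rewrite !mxE.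
under eq_bigr => k _ do rewrite !mxE -normCK.
rewrite psumr_eq0 => [/allP/(_ j)|k _]; last exact: exprn_ge0.
by rewrite mem_index_enum => /(_ isT).
Qed.

Lemma row_free_gram m n (A : 'M[C]_(m, n)) :
  row_free A -> A *m A^t* \in unitmx.
Proof.
move=> fA; rewrite -row_free_unit -kermx_eq0; apply/eqP.
have /mulmx_ct_eq0 kA0 : kermx (A *m A^t*) *m A *m (kermx (A *m A^t*) *m A)^t* = 0.
  by rewrite ctmxM !mulmxA -(mulmxA _ A) mulmx_ker mul0mx.
by apply: (row_free_inj fA); rewrite kA0 mul0mx.
Qed.

Lemma ctmx_inv n (A : 'M[C]_n) : A^t* = A -> (invmx A)^t* = invmx A.
Proof. by move=> AE; rewrite trmx_inv map_invmx AE. Qed.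

(* The inverse is built from the full rank factorization A = K *m L, as
   L^* (L L^* )^-1 (K^* K)^-1 K^*. *)
Lemma penrose_exists m n (A : 'M[C]_(m, n)) : exists X, penrose A X.
Proof.
have [r [K [L [AE fK fL]]]] : exists r (K : 'M_(m, r)) (L : 'M_(r, n)),
    [/\ A = K *m L, row_full K & row_free L].
  exists (\rank A), (col_base A), (row_base A).
  by rewrite mulmx_base col_base_full row_base_free.
have uL : L *m L^t* \in unitmx by exact: row_free_gram.
have uK : K^t* *m K \in unitmx.
  rewrite -{2}[K]trmxCK; apply: row_free_gram.
  by rewrite /row_free mxrank_map mxrank_tr.
have hL : (L *m L^t*)^t* = L *m L^t* by rewrite ctmxM trmxCK.
have hK : (K^t* *m K)^t* = K^t* *m K by rewrite ctmxM trmxCK.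
pose X := L^t* *m invmx (L *m L^t*) *m (invmx (K^t* *m K) *m K^t*).
have AX : A *m X = K *m invmx (K^t* *m K) *m K^t*.
  rewrite AE /X !mulmxA -(mulmxA K L) -(mulmxA K (L *m _)).
  by rewrite mulmxV // mulmx1.
have XA : X *m A = L^t* *m invmx (L *m L^t*) *m L.
  rewrite AE /X !mulmxA -(mulmxA _ (K^t*) K) -(mulmxA _ _ (K^t* *m K)).
  by rewrite mulVmx // mulmx1.
exists X; apply/and4P; split; apply/eqP.
- by rewrite AX AE !mulmxA -(mulmxA _ (K^t*) K) -(mulmxA K) mulVmx // mulmx1.
- rewrite XA /X !mulmxA -(mulmxA _ L (L^t*)) -(mulmxA _ _ (L *m L^t*)).
  by rewrite mulVmx // mulmx1.
- by rewrite AX !ctmxM trmxCK ctmx_inv // mulmxA.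
- by rewrite XA !ctmxM trmxCK ctmx_inv // mulmxA.
Qed.

Lemma penrose_unique m n (A : 'M[C]_(m, n)) X Y :
  penrose A X -> penrose A Y -> X = Y.
Proof.
move=> /and4P[/eqP X1 /eqP X2 /eqP X3 /eqP X4].
move=> /and4P[/eqP Y1 /eqP Y2 /eqP Y3 /eqP Y4].
have AXY : A *m X = A *m Y.
  rewrite -X3 -{1}Y1 -(mulmxA (A *m Y)) ctmxM X3 Y3.
  by rewrite mulmxA X1.
have XYA : X *m A = Y *m A.
  rewrite -X4 -{1}Y1 -(mulmxA A Y) (mulmxA X A) ctmxM X4 Y4.
  by rewrite -mulmxA (mulmxA A) X1.
by rewrite -X2 XYA -mulmxA AXY mulmxA.
Qed.

Definition mpinv m n (A : 'M[C]_(m, n)) : 'M[C]_(n, m) :=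
  xchoose (penrose_exists A).

Lemma mpinvP m n (A : 'M[C]_(m, n)) : penrose A (mpinv A).
Proof. exact: xchooseP. Qed.

Lemma mpinv_unique m n (A : 'M[C]_(m, n)) X : penrose A X -> X = mpinv A.
Proof. by move=> /penrose_unique; apply; exact: mpinvP. Qed.

Definition geninv n (A B : 'M[C]_n) : 'M[C]_n := mpinv (A *m B *m mpinv B).

End MoorePenrose.

(* Main.v *)
Require Import Defs.
From mathcomp Require Import all_boot all_order all_algebra.
From mathcomp Require Import complex.
From mathcomp Require Import boolp classical_sets reals.
Set Implicit Arguments.
Unset Strict Implicit.
Unset Printing Implicit Defensive.
Import Order.TTheory GRing.Theory Num.Theory.

Local Open Scope ring_scope.
Local Open Scope sesquilinear_scope.

(** Let [P] be [B *m mpinv B], the orthogonal projector onto the range of [B],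
    and [M := A *m P], so that [geninv A B] is the Moore-Penrose inverse [X]
    of [M].

    A Moore-Penrose inverse always has the range and the null space of the
    conjugate transpose ([mxrange_mpinv], [mxnull_mpinv]).  As [P] is Hermitian,
    the conjugate transpose of [M] is [P *m A^t*], which gives the range of
    [X]; as [A *m B] and [M] are right multiples of each other, their conjugate
    transposes have the same null space, which gives the null space of [X].

    The range of [X] thus lies in that of [P], so [P *m X = X]
    ([projB_geninv]) and hence [A *m X = M *m X] ([mulmx_geninv]).  This
    exchange of [A] and [M] drives the rest: [X *m A *m X = X *m M *m X = X];
    and [A *m X] factors through [A *m B], so that [A *m X *m A = A] forces
    [A *m B] to have the rank of [A].  Conversely, equal ranks make [A] a
    right multiple of [A *m B = M *m B], and [M *m X] fixes every right
    multiple of [M]. *)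

Section Factorizations.
Context {C : numClosedFieldType}.

Lemma eq_mxrange m n p (M : 'M[C]_(m, n)) (N : 'M[C]_(m, p)) K L :
  M = N *m K -> N = M *m L -> mxrange M = mxrange N.
Proof.
move=> MN NM; apply/seteqP; split=> _ [x _ <-].
  by exists (K *m x) => //; rewrite mulmxA -MN.
by exists (L *m x) => //; rewrite mulmxA -NM.
Qed.

Lemma eq_mxnull m n p (M : 'M[C]_(m, n)) (N : 'M[C]_(p, n)) K L :
  M = K *m N -> N = L *m M -> mxnull M = mxnull N.
Proof.
move=> MN NM; apply/seteqP; split=> x; rewrite /mxnull /= => x0.
  by rewrite NM -mulmxA x0 mulmx0.
by rewrite MN -mulmxA x0 mulmx0.
Qed.

(** [A *m B] always has its column space inside that of [A]; equal dimensions
    make the two column spaces coincide. *)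
Lemma mxrank_mulmx_factor m n p (A : 'M[C]_(m, n)) (B : 'M[C]_(n, p)) :
  \rank (A *m B) = \rank A -> exists W, A = A *m B *m W.
Proof.
move=> rAB; have sAB : ((A *m B)^T <= A^T)%MS by rewrite trmx_mul submxMl.
have /submxP[D AE] : (A^T <= (A *m B)^T)%MS.
  by rewrite -(mxrank_leqif_sup sAB) !mxrank_tr rAB.
by exists D^T; rewrite -[LHS]trmxK AE trmx_mul trmxK.
Qed.

End Factorizations.

Section MoorePenroseTheory.
Context {C : numClosedFieldType} (m n : nat).
Implicit Type M : 'M[C]_(m, n).

Lemma mulmx_mpinvK M : M *m mpinv M *m M = M.
Proof. by have /and4P[/eqP] := mpinvP M. Qed.

Lemma mpinv_mulmxK M : mpinv M *m M *m mpinv M = mpinv M.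
Proof. by have /and4P[_ /eqP] := mpinvP M. Qed.

Lemma ctmx_mulmx_mpinv M : (M *m mpinv M)^t* = M *m mpinv M.
Proof. by have /and4P[_ _ /eqP] := mpinvP M. Qed.

Lemma ctmx_mpinv_mulmx M : (mpinv M *m M)^t* = mpinv M *m M.
Proof. by have /and4P[_ _ _ /eqP] := mpinvP M. Qed.

(** Conjugating the Hermitian projector [mpinv M *m M] in
    [mpinv M = mpinv M *m M *m mpinv M] brings [M^t*] to the front. *)
Lemma mpinv_factorl M : mpinv M = M^t* *m ((mpinv M)^t* *m mpinv M).
Proof.
by rewrite mulmxA -ctmxM ctmx_mpinv_mulmx mpinv_mulmxK.
Qed.

(** Each of [mpinv M] and [M^t*] is fixed by left multiplication by the
    Hermitian projector [mpinv M *m M], so each is a right multiple of the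
    other. *)
Lemma mxrange_mpinv M : mxrange (mpinv M) = mxrange (M^t*).
Proof.
apply: (eq_mxrange (L := M *m M^t*)); first exact: mpinv_factorl.
by rewrite mulmxA -ctmx_mpinv_mulmx -ctmxM mulmxA mulmx_mpinvK.
Qed.

(** The same argument as for the range, with the projector [M *m mpinv M]. *)
Lemma mxnull_mpinv M : mxnull (mpinv M) = mxnull (M^t*).
Proof.
apply: (eq_mxnull (K := mpinv M *m (mpinv M)^t*) (L := M^t* *m M)).
  by rewrite -mulmxA -ctmxM ctmx_mulmx_mpinv mulmxA mpinv_mulmxK.
by rewrite -mulmxA -ctmx_mulmx_mpinv -ctmxM mulmx_mpinvK.
Qed.

End MoorePenroseTheory.

Section GeneralizedInverse.
Context {C : numClosedFieldType} (n : nat).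
Implicit Types A B : 'M[C]_n.

Lemma ctmx_mulmx_projB A B :
  (A *m B *m mpinv B)^t* = B *m mpinv B *m A^t*.
Proof. by rewrite -mulmxA ctmxM ctmx_mulmx_mpinv. Qed.

Lemma mxrange_geninv A B :
  mxrange (geninv A B) = mxrange (B *m mpinv B *m A^t*).
Proof. by rewrite mxrange_mpinv ctmx_mulmx_projB. Qed.

Lemma mxnull_geninv A B : mxnull (geninv A B) = mxnull ((A *m B)^t*).
Proof.
rewrite mxnull_mpinv; apply: (eq_mxnull (L := B^t*)); first exact: ctmxM.
by rewrite -ctmxM -!mulmxA (mulmxA B) mulmx_mpinvK.
Qed.

(** The range of [geninv A B] lies in the range of [B], which the projector
    [B *m mpinv B] fixes pointwise. *)
Lemma projB_geninv A B : B *m mpinv B *m geninv A B = geninv A B.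
Proof.
rewrite /geninv (mpinv_factorl (A *m B *m mpinv B)).
by rewrite ctmx_mulmx_projB !mulmxA mulmx_mpinvK.
Qed.

(** In front of [geninv A B], the matrix [A] may be traded for the matrix that
    [geninv A B] is the Moore-Penrose inverse of. *)
Lemma mulmx_geninv A B :
  A *m geninv A B = A *m B *m mpinv B *m geninv A B.
Proof. by rewrite -[in LHS]projB_geninv !mulmxA. Qed.

Lemma two_inverses_geninv A B : two_inverses A (geninv A B).
Proof.
by rewrite /two_inverses /= -mulmxA mulmx_geninv mulmxA mpinv_mulmxK.
Qed.

Lemma one_inverses_geninv A B :
  one_inverses A (geninv A B) <-> \rank (A *m B) = \rank A.
Proof.
rewrite /one_inverses /=; split=> [AXA | /mxrank_mulmx_factor[W AE]].
  apply/eqP; rewrite eqn_leq mxrankM_maxl -{1}AXA mulmx_geninv.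
  by rewrite -!(mulmxA (A *m B)) mxrankM_maxl.
(* [A *m B] is a right multiple of [A *m B *m mpinv B], hence so is [A]. *)
have AM : A = A *m B *m mpinv B *m (B *m W).
  by rewrite mulmxA -!(mulmxA A) mulmx_mpinvK mulmxA.
by rewrite mulmx_geninv [X in _ *m X]AM mulmxA mulmx_mpinvK -AM.
Qed.

End GeneralizedInverse.

Theorem theorem3p1 (R : realType) (n : nat) (A B : 'M[R[i]]_n) :
  [/\ mxrange (geninv A B) = mxrange (B *m mpinv B *m A^t*)
      /\ mxnull (geninv A B) = mxnull ((A *m B)^t*),
      two_inverses A (geninv A B)
    & one_inverses A (geninv A B) <-> \rank (A *m B) = \rank A].
Proof.
split.
- by split; [exact: mxrange_geninv | exact: mxnull_geninv].
- exact: two_inverses_geninv.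
- exact: one_inverses_geninv.
Qed.
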